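(* Let $\{F_i\}$ be a family of matrices in $\mathbb{R}^{n\times n}$, let $H$ be a real matrix with $n$ columns, and let $\mathcal{I}\subseteq\mathbb{R}^n$. Let $\mathcal{R}\subseteq\mathbb{R}^n$ be a linear subspace with $\mathcal{I}\subseteq\mathcal{R}$ and $F_i\mathcal{R}\subseteq\mathcal{R}$ for all $i$, and let $\tilde{\mathcal{N}}\subseteq\mathbb{R}^n$ be a linear subspace with $\tilde{\mathcal{N}}\subseteq\ker H$ and $F_i\tilde{\mathcal{N}}\subseteq\tilde{\mathcal{N}}$ for all $i$. Let $\mathcal{E}$ be any linear subspace with $\mathcal{R}=(\mathcal{R}\cap\tilde{\mathcal{N}})\oplus\mathcal{E}$. Let $\mathcal{V}\subseteq\mathbb{R}^n$ be any linear subspace with $\mathcal{E}\subseteq\mathcal{V}$, $m=\dim\mathcal{V}$, and let $\Pi_{\mathcal{V}}$ be the orthogonal projection onto $\mathcal{V}$ with respect to some inner product on $\mathbb{R}^n$. Assume $\Pi_{\mathcal{V}}(\mathcal{R}\cap\tilde{\mathcal{N}})\subseteq\mathcal{R}\cap\tilde{\mathcal{N}}$, and let $R:\mathbb{R}^n\to\mathbb{R}^m$ and $J:\mathbb{R}^m\to\mathcal{V}$ be linear maps with $\Pi_{\mathcal{V}}=JR$. Put $\check F_i=RF_iJ$, $\check H=HJ$. Then for every finite sequence $s_0,\dots,s_l$ of indices and every $x_0\in\mathrm{span}(\mathcal{I})$, with $\check x_0=Rx_0$, $$H F_{s_l}F_{s_{l-1}}\cdots F_{s_0}x_0=\check H\check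 F_{s_l}\check F_{s_{l-1}}\cdots\check F_{s_0}\check x_0 .$$
   Context: The setting is the discrete-time autonomous switching linear system $x(t+1)=F_ix(t)$, $y(t)=Hx(t)$, $x(0)\in\mathcal{I}$, where the matrix $F_i$ applied at each time is selected by the sequence $s$; the conclusion says that the reduced system $(\{\check F_i\},\check H,R\mathcal{I})$ reproduces its outputs. *)

(* Defs.v *)
(* Vectors are column vectors 'cV[K]_n and
   matrices act on the left; subspaces are terms of {vspace 'cV[K]_n}. *)
From mathcomp Require Export all_boot all_order all_algebra sesquilinear.
From mathcomp Require Export classical_sets reals.

Set Implicit Arguments.
Unset Strict Implicit.
Unset Printing Implicit Defensive.

Local Open Scope ring_scope.
Local Open Scope classical_set_scope.

Definition mxlin (K : realType) (p q : nat) (A : 'M[K]_(p, q)) :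
  'Hom('cV[K]_q, 'cV[K]_p) := linfun (mulmx A).

(* The library span <<vs>> is defined for finite sequences only; the span of an
   arbitrary set collects the linear combinations of its finite families. *)
Definition span_set (K : realType) (n : nat) (A : set 'cV[K]_n) :
  set 'cV[K]_n :=
  [set x | exists2 vs : seq 'cV[K]_n, [set` vs] `<=` A & x \in <<vs>>%VS].

Definition orthogonal_projection (K : realType) (n : nat)
    (dotp : {dot 'cV[K]_n for idfun}) (V : {vspace 'cV[K]_n})
    (P : 'M[K]_n) : Prop :=
  forall x : 'cV[K]_n,
    P *m x \in V /\ {in V, forall v, dotp (x - P *m x) v = 0}.

(* F_(s l) *m ... *m F_(s 1) *m F_(s 0): [\prod] multiplies from left to right
   and [rev_ord t] has value l - t, so the latest index comes leftmost. *)
Definition switch_prod (K : realType) (n : nat) (Idx : Type)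
    (F : Idx -> 'M[K]_n) (l : nat) (s : 'I_l.+1 -> Idx) : 'M[K]_n :=
  \prod_(t < l.+1) F (s (rev_ord t)).

(* Main.v *)
(** Modulo the part of [N] reachable inside [Rs], the projection [Pi] acts on
    [Rs] as the identity: it fixes [E], which lies in [V], and stabilises
    [Rs :&: N].  Hence the reduced state, lifted back by [J], tracks the full
    state up to an error in [Rs :&: N].  This error stays there, because
    [Rs :&: N] is invariant, and [H] does not see it. *)
Require Import Defs.

Import Order.TTheory GRing.Theory.

Set Implicit Arguments.
Unset Strict Implicit.
Unset Printing Implicit Defensive.

Local Open Scope ring_scope.
Local Open Scope classical_set_scope.

Lemma mxlinE (K : realType) (p q : nat) (A : 'M[K]_(p, q)) (x : 'cV[K]_q) :
  mxlin A x = A *m x.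
Proof. by rewrite lfunE. Qed.

Lemma mxlin_img_sub (K : realType) (p q : nat) (A : 'M[K]_(p, q))
    (U : {vspace 'cV[K]_q}) (W : {vspace 'cV[K]_p}) (x : 'cV[K]_q) :
  (mxlin A @: U <= W)%VS -> x \in U -> A *m x \in W.
Proof. by move=> AUW xU; rewrite -mxlinE (subvP AUW)// memv_img. Qed.

Lemma span_set_sub (K : realType) (n : nat) (A : set 'cV[K]_n)
    (U : {vspace 'cV[K]_n}) :
  A `<=` [set` U] -> span_set A `<=` [set` U].
Proof.
move=> AU x [vs vsA] /=; apply: (subvP _).
by apply/span_subvP => v /vsA /AU.
Qed.

(** For [v] in [V] the residual [v - P *m v] lies in [V] and is orthogonal to [V], hence to itself;
    positive definiteness makes it vanish. *)
Lemma orthogonal_projection_id (K : realType) (n : nat)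
    (dotp : {dot 'cV[K]_n for idfun}) (V : {vspace 'cV[K]_n}) (P : 'M[K]_n) :
  orthogonal_projection dotp V P -> {in V, forall v, P *m v = v}.
Proof.
move=> PV v vV; have [PvV orth] := PV v.
apply/esym/eqP; rewrite -subr_eq0; apply/negPn/negP.
by move=> /(neq0_dnorm_gt0 (s := dotp)); rewrite orth ?ltxx// memvB.
Qed.

(** Writing [x = w + e], the part [e] cancels and [w - P *m w] remains. *)
Lemma sub_proj_mem (K : realType) (n : nat) (P : 'M[K]_n)
    (W E : {vspace 'cV[K]_n}) (x : 'cV[K]_n) :
  {in W, forall w, P *m w \in W} -> {in E, forall e, P *m e = e} ->
  x \in (W + E)%VS -> x - P *m x \in W.
Proof.
move=> PW PE /memv_addP[w wW [e eE ->]].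
by rewrite mulmxDr (PE e eE) opprD addrACA subrr addr0 memvB// PW.
Qed.

(** Splits off the latest switch, so that induction extends a trajectory by one step in time. The
    product is left unfolded because the remaining one may be empty, which [switch_prod]
    excludes. *)
Lemma switch_prod_recl (K : realType) (n : nat) (Idx : Type)
    (F : Idx -> 'M[K]_n) (l : nat) (s : 'I_l.+1 -> Idx) :
  \prod_(t < l.+1) F (s (rev_ord t)) =
  F (s ord_max) *m \prod_(t < l) F (s (widen_ord (leqnSn l) (rev_ord t))).
Proof.
rewrite big_ord_recl; congr (F (s _) *m _).
  by apply: val_inj => /=; rewrite subn1.
by apply: eq_bigr => t _; congr (F (s _)); apply: val_inj.
Qed.

(** Induction on the length, starting from the empty product, where the error is [x - J *m R *m x].
    Membership of [z] in [U] is carried along because [J *m R] is controlled only on [U]. *)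
Lemma reduced_state_error (K : realType) (n m : nat) (Idx : Type)
    (F : Idx -> 'M[K]_n) (U W : {vspace 'cV[K]_n})
    (R : 'M[K]_(m, n)) (J : 'M[K]_(n, m)) :
  (W <= U)%VS ->
  (forall i, {in U, forall x, F i *m x \in U}) ->
  (forall i, {in W, forall x, F i *m x \in W}) ->
  {in U, forall x, x - J *m R *m x \in W} ->
  forall (l : nat) (s : 'I_l -> Idx), {in U, forall x,
    let z := \prod_(t < l) F (s (rev_ord t)) *m x in
    let y := J *m (\prod_(t < l) (R *m F (s (rev_ord t)) *m J) *m (R *m x)) in
    z \in U /\ z - y \in W}.
Proof.
move=> WU FU FW JR; elim=> [|l IHl] s x xU /=.
  by rewrite !big_ord0 !mul1mx mulmxA; split; [|exact: JR].
rewrite (switch_prod_recl F) (switch_prod_recl (fun i => R *m F i *m J)).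
have [] := IHl (s \o widen_ord (leqnSn l)) x xU.
rewrite /= -!mulmxA.
move: (_ *m x) (_ *m (R *m x)) => z y zU zyW; split; first exact: FU.
(* The lifted reduced state differs from [z] by an element of [W], which lies in [U]. *)
have yU : J *m y \in U by rewrite -[J *m y](subKr z) memvB// (subvP WU).
(* The new error is the old one propagated by [F], plus the fresh error of projecting
   [F (s ord_max) *m (J *m y)]. *)
rewrite -(subrKA (F (s ord_max) *m (J *m y))) memvD//.
  by rewrite -mulmxBr FW.
by rewrite [X in _ - X]mulmxA JR// FU.
Qed.

Theorem theorem4 (K : realType) (n q m : nat) (Idx : Type)
  (F : Idx -> 'M[K]_n) (H : 'M[K]_(q, n)) (I : set 'cV[K]_n)
  (Rs : {vspace 'cV[K]_n})
  (I_sub_Rs : I `<=` [set` Rs])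
  (Rs_invariant : forall i : Idx, (mxlin (F i) @: Rs <= Rs)%VS)
  (N : {vspace 'cV[K]_n})
  (N_sub_kerH : (N <= lker (mxlin H))%VS)
  (N_invariant : forall i : Idx, (mxlin (F i) @: N <= N)%VS)
  (E : {vspace 'cV[K]_n})
  (Rs_sum : Rs = (Rs :&: N + E)%VS)
  (Rs_direct : directv (Rs :&: N + E)%VS)
  (V : {vspace 'cV[K]_n})
  (E_sub_V : (E <= V)%VS)
  (m_dimV : m = \dim V)
  (dotp : {dot 'cV[K]_n for idfun})
  (Pi : 'M[K]_n)
  (Pi_proj : orthogonal_projection dotp V Pi)
  (Pi_RsN : (mxlin Pi @: (Rs :&: N) <= Rs :&: N)%VS)
  (R : 'M[K]_(m, n)) (J : 'M[K]_(n, m))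
  (J_in_V : (limg (mxlin J) <= V)%VS)
  (Pi_fact : Pi = J *m R) :
  forall (l : nat) (s : 'I_l.+1 -> Idx) (x0 : 'cV[K]_n),
    span_set I x0 ->
    H *m switch_prod F s *m x0 =
    (H *m J) *m switch_prod (fun i => R *m F i *m J) s *m (R *m x0).
Proof.
move=> l s x0 x0I.
set W := (Rs :&: N)%VS.
have FRs i : {in Rs, forall x, F i *m x \in Rs}.
  by move=> x; apply: mxlin_img_sub.
have FW i : {in W, forall x, F i *m x \in W}.
  move=> x; rewrite !memv_cap => /andP[xRs xN].
  by rewrite FRs// (mxlin_img_sub (N_invariant i)).
have JR : {in Rs, forall x, x - J *m R *m x \in W}.
  move=> x; rewrite -Pi_fact {1}Rs_sum; apply: sub_proj_mem => [w|e /(subvP E_sub_V)].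
    exact: mxlin_img_sub.
  exact: (orthogonal_projection_id Pi_proj).
have x0Rs : x0 \in Rs := span_set_sub I_sub_Rs x0I.
have [_] := reduced_state_error (capvSl _ _) FRs FW JR s x0Rs.
(* The final error lies in [N], so [H] kills it and the outputs agree. *)
rewrite memv_cap => /andP[_ /(subvP N_sub_kerH)].
by rewrite memv_ker mxlinE mulmxBr subr_eq0 !mulmxA => /eqP.
Qed.
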